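(* Let $G$ be a finitely generated LERF group with positive rank gradient $\nabla G>0$, let $n\in\mathbb{N}$, and let $H_1,\dots,H_n$ be finitely generated subgroups of infinite index in $G$. Then $H_1H_2\cdots H_n\subsetneq G$, where $H_1H_2\cdots H_n=\{h_1h_2\cdots h_n : h_i\in H_i\}$.
   Context: For a group $U$, $d(U)$ denotes the minimal cardinality of a generating set of $U$. The rank gradient of a finitely generated group $G$ is $\nabla G=\inf_U \frac{d(U)-1}{[G:U]}$, where $U$ ranges over all finite index subgroups of $G$. A group $G$ is LERF (subgroup separable) if every finitely generated subgroup of $G$ is the intersection of some collection of finite index subgroups of $G$. *)

(* Defs.v *)
From mathcomp Require Import all_boot all_order all_algebra.
From mathcomp Require Import boolp classical_sets reals Rstruct.
From Stdlib Require Import List.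
Set Implicit Arguments. Unset Strict Implicit. Unset Printing Implicit Defensive.
Import Order.TTheory GRing.Theory Num.Theory.

Record group := Group {
  carrier :> Type;
  gmul : carrier -> carrier -> carrier;
  ginv : carrier -> carrier;
  gone : carrier;
  gmulA : forall x y z, gmul x (gmul y z) = gmul (gmul x y) z;
  gmul1l : forall x, gmul gone x = x;
  gmulVl : forall x, gmul (ginv x) x = gone
}.

Section GroupDefs.
Variable G : group.

Definition is_subgroup (U : G -> Prop) : Prop :=
  U (gone G) /\ (forall x y, U x -> U y -> U (gmul x y)) /\ (forall x, U x -> U (ginv x)).

Definition generated (s : list G) (g : G) : Prop :=
  forall K : G -> Prop, is_subgroup K -> (forall x, List.In x s -> K x) -> K g.

Definition generates (s : list G) (U : G -> Prop) : Prop :=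
  forall g, generated s g <-> U g.

Definition fin_gen (U : G -> Prop) : Prop := exists s : list G, generates s U.

Definition fin_gen_group : Prop := fin_gen (fun _ => True).

Definition has_index (U : G -> Prop) (n : nat) : Prop :=
  exists r : nat -> G, forall g, exists i, (i < n)%N /\ U (gmul (ginv (r i)) g) /\
     forall j, (j < n)%N -> U (gmul (ginv (r j)) g) -> j = i.

Definition finite_index (U : G -> Prop) : Prop := exists n, has_index U n.

Definition rank_is (U : G -> Prop) (k : nat) : Prop :=
  (exists s : list G, size s = k /\ generates s U) /\
  (forall s : list G, generates s U -> (k <= size s)%N).

Definition rank_gradient : Rdefinitions.R :=
  inf [set x : Rdefinitions.R | exists (U : G -> Prop) (n k : nat),
        is_subgroup U /\ has_index U n /\ rank_is U k /\
        x = ((k%:R - 1) / n%:R)%R].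

Definition LERF : Prop :=
  forall H : G -> Prop, is_subgroup H -> fin_gen H ->
    exists C : (G -> Prop) -> Prop,
      (forall K, C K -> is_subgroup K /\ finite_index K) /\
      (forall g, H g <-> (forall K, C K -> K g)).

Fixpoint prod_set (H : nat -> G -> Prop) (n : nat) : G -> Prop :=
  match n with
  | 0 => fun g => g = gone G
  | m.+1 => fun g => exists x h, prod_set H m x /\ H m h /\ g = gmul x h
  end.

End GroupDefs.

(* Main.v *)
From HB Require Import structures.
From mathcomp Require Import fingroup perm gproduct.
Require Import Defs.
From mathcomp Require Import all_boot all_order all_algebra.
From mathcomp Require Import boolp classical_sets reals Rstruct.
From mathcomp Require Import zify.
Set Implicit Arguments. Unset Strict Implicit. Unset Printing Implicit Defensive.
Import Order.TTheory GRing.Theory Num.Theory.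

Local Open Scope group_scope.
Local Open Scope classical_set_scope.

(** Call a subgroup thin if it is finitely generated of infinite index. By LERF,
    any number of cosets of a thin subgroup can be told apart in a finite
    quotient [q] of [G], so the image of the subgroup has density as small as we
    like once [q] is fine enough. Hence [G] is not a finite union of two-sided
    translates [x U y] of thin subgroups. The product of two thin subgroups [A]
    and [B], however, is contained in such a union: by Schreier's lemma
    [A ∩ ker q] and [B ∩ ker q] have at most [d(A) |q(A)|] and [d(B) |q(B)|]
    generators, in total at most [∇G |q(G)|] for [q] fine enough, so that they
    generate a subgroup [C] of [ker q] of infinite index, and [A B] is covered
    by the finitely many [a C b] with [a] and [b] representatives of the fibers
    of [q] in [A] and [B]. Therefore the subsets of finite unions of such
    translates are stable under multiplication by thin subgroups, and
    [H_1 ... H_n] is one of them. *)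

Lemma In_mem (T : eqType) (x : T) (s : seq T) : List.In x s <-> x \in s.
Proof.
elim: s => //= y s IH; rewrite inE; split.
  by case=> [->|/IH ->]; rewrite ?eqxx ?orbT.
by case/predU1P => [->|/IH]; [left | right].
Qed.

(** * Subgroups and cosets *)

Section GroupInstance.
Variable G : group.

Fact gmulgV : right_inverse (gone G) (@ginv G) (@gmul G).
Proof.
move=> x; rewrite -[LHS]gmul1l -(gmulVl (ginv x)) -gmulA (gmulA (ginv x)).
by rewrite gmulVl gmul1l.
Qed.

Fact gmulg1 : right_id (gone G) (@gmul G).
Proof. by move=> x; rewrite -(gmulVl x) gmulA gmulgV gmul1l. Qed.

HB.instance Definition _ := gen_eqMixin G.
HB.instance Definition _ := gen_choiceMixin G.
HB.instance Definition _ :=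
  isGroup.Build G (@gmulA G) (@gmul1l G) gmulg1 (@gmulVl G) gmulgV.

End GroupInstance.

(* The conjugate [g U g^-1]. *)
Definition conj_set (G : group) (U : set G) (g : G) : set G :=
  [set x | U (x ^ g)].
Arguments conj_set G U g x /.

Definition translate_set (G : group) (x : G) (S : set G) (y : G) : set G :=
  [set (x * z * y)%g | z in S].

Definition mul_set (G : group) (S T : set G) : set G :=
  [set (x * y)%g | x in S & y in T].

Section Subgroups.
Variable G : group.
Implicit Types (x y z g : G) (s : seq G) (U K : set G).

Lemma subgroup1 U : is_subgroup U -> U 1.
Proof. by case. Qed.

Lemma subgroupM U x y : is_subgroup U -> U x -> U y -> U (x * y).
Proof. by case=> _ [UM _]; apply: UM. Qed.

Lemma subgroupV U x : is_subgroup U -> U x -> U x^-1.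
Proof. by case=> _ [_ UV]; apply: UV. Qed.

Lemma subgroup_set1 : is_subgroup [set 1 : G].
Proof.
split=> //; split=> [_ _ -> ->|_ ->]; first exact: mul1g.
exact: invg1.
Qed.

Lemma subgroup_conj U g : is_subgroup U -> is_subgroup (conj_set U g).
Proof.
move=> Usub; split; first by rewrite /= conj1g; exact: subgroup1.
split=> [x y Ux Uy|x Ux] /=.
  by rewrite conjMg; exact: subgroupM.
by rewrite conjVg; exact: subgroupV.
Qed.

Lemma subgroupI U K :
  is_subgroup U -> is_subgroup K -> is_subgroup (U `&` K).
Proof.
move=> Usub Ksub; split; first by split; exact: subgroup1.
split=> [x y [Ux Kx] [Uy Ky]|x [Ux Kx]].
  by split; exact: subgroupM.
by split; exact: subgroupV.
Qed.

Lemma generated_subgroup s : is_subgroup (generated s).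
Proof.
split; first by move=> K Ksub _; exact: subgroup1.
split=> [x y sx sy|x sx] K Ksub sK.
  by apply: subgroupM => //; [exact: sx | exact: sy].
by apply: subgroupV => //; exact: sx.
Qed.

Lemma mem_generated s x : x \in s -> generated s x.
Proof. by move=> /In_mem sx K _; exact. Qed.

Lemma generated_min s K : is_subgroup K -> (forall x, x \in s -> K x) ->
  generated s `<=` K.
Proof. by move=> Ksub sK g; apply=> // x /In_mem /sK. Qed.

Lemma generates_mem s U x : generates s U -> x \in s -> U x.
Proof. by move=> gens sx; apply/gens; exact: mem_generated. Qed.

Lemma generates_conj s U g : is_subgroup U -> generates s U ->
  generates [seq x ^ g^-1 | x <- s] (conj_set U g).
Proof.
move=> Usub gens x; split.
  apply: generated_min; first exact: subgroup_conj.
  move=> _ /mapP[y sy ->] /=; rewrite conjgKV.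
  exact: generates_mem sy.
move=> /gens; rewrite -{2}[x](conjgK g).
apply: (generated_min (subgroup_conj g^-1 (generated_subgroup _))) => y sy /=.
by apply: mem_generated; exact: map_f.
Qed.

Lemma has_index_cosets U n : is_subgroup U -> has_index U n ->
  exists (c : G -> 'I_n) (r : 'I_n -> G),
    cancel r c /\ forall x y, c x = c y <-> U (x^-1 * y).
Proof.
move=> Usub [r rP].
have /choice[c cP] x : exists i : 'I_n, U ((r i)^-1 * x) /\
    forall j : 'I_n, U ((r j)^-1 * x) -> j = i.
  have [i [i_lt [Ui i_uniq]]] := rP x; exists (Ordinal i_lt); split=> // j Uj.
  by apply/val_inj/i_uniq => //; exact: ltn_ord.
exists c, (r \o val); split=> [i|x y].
  by apply/esym; apply: (cP _).2; rewrite mulVg; exact: subgroup1.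
split=> [cxy|Uxy].
  have := subgroupM Usub (subgroupV Usub (cP x).1) (cP y).1.
  by rewrite cxy invgM invgK -mulgA mulVKg.
by apply: (cP y).2; have := subgroupM Usub (cP x).1 Uxy; rewrite -mulgA mulVKg.
Qed.

Lemma has_index_gt0 U n : has_index U n -> (0 < n)%N.
Proof. by move=> [r /(_ 1)[i [+ _]]]; exact: leq_ltn_trans. Qed.

Lemma has_index_conj U g n :
  has_index (conj_set U g) n -> has_index U n.
Proof.
move=> [r rP]; exists (fun i => r i ^ g) => x.
have rE i : ((r i)^-1 * x ^ g^-1) ^ g = (r i ^ g)^-1 * x.
  by rewrite conjMg conjVg conjgKV.
have [i [i_lt [Ui i_uniq]]] := rP (x ^ g^-1); exists i; split=> //.
split=> [|j j_lt Uj]; first by move: Ui; rewrite /= rE.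
by apply: i_uniq => //=; rewrite rE.
Qed.

Lemma has_index_transversal U n (r : nat -> G) : is_subgroup U ->
  (forall i j, (i < j < n)%N -> ~ U ((r i)^-1 * r j)) ->
  (forall g, exists2 i, (i < n)%N & U ((r i)^-1 * g)) -> has_index U n.
Proof.
move=> Usub r_inequiv r_cover; exists r => g.
have [i i_lt Ui] := r_cover g; exists i; do 2![split=> //] => j j_lt Uj.
have Urr k l : U ((r k)^-1 * g) -> U ((r l)^-1 * g) -> U ((r k)^-1 * r l).
  move=> Uk Ul; have := subgroupM Usub Uk (subgroupV Usub Ul).
  by rewrite invgM invgK -mulgA mulVKg.
have [ji|ij|//] := ltngtP j i.
  by case: (r_inequiv j i); [rewrite ji | exact: Urr].
by case: (r_inequiv i j); [rewrite ij | exact: Urr].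
Qed.

Lemma infinite_index_inequiv U n : is_subgroup U -> ~ finite_index U ->
  exists r : nat -> G, forall i j, (i < j < n)%N -> ~ U ((r i)^-1 * r j).
Proof.
move=> Usub Uinf; elim: n => [|n [r r_inequiv]].
  by exists (fun=> 1) => i j; rewrite ltn0 andbF.
have [g gP] : exists g, forall i, (i < n)%N -> ~ U ((r i)^-1 * g).
  apply: contra_notP Uinf => /forallNP r_cover; exists n.
  apply: has_index_transversal r_inequiv _ => // g.
  by have /existsNP[i /not_implyP[i_lt /contrapT Ui]] := r_cover g; exists i.
exists (fun k => if k == n then g else r k) => i j /andP[ij jn].
have i_lt : (i < n)%N by lia.
rewrite (ltn_eqF i_lt); case: eqVneq => j_neq; first exact: gP.
by apply: r_inequiv; lia.
Qed.

End Subgroups.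

Section RankGradient.
Variable G : group.
Implicit Types (s : seq G) (U : set G).

Lemma ex_rank_is s U : generates s U ->
  exists2 k, rank_is U k & (k <= size s)%N.
Proof.
move=> gens.
have rank_ex : exists k, `[< exists s', size s' = k /\ generates s' U >].
  by exists (size s); apply/asboolP; exists s.
have [k /asboolP k_gens k_min] := ex_minnP rank_ex.
have U_rank : rank_is U k.
  by split=> // s' gens'; apply: k_min; apply/asboolP; exists s'.
by exists k => //; exact: U_rank.2.
Qed.

Lemma rank_gradient_le s U n : is_subgroup U -> generates s U ->
  has_index U n -> (rank_gradient G * n%:R <= (size s)%:R - 1)%R.
Proof.
move=> Usub gens Un; have n_gt0 := has_index_gt0 Un.
have [k U_rank k_le] := ex_rank_is gens.
rewrite -ler_pdivlMr ?ltr0n //.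
apply: (@le_trans _ _ ((k%:R - 1) / n%:R)%R); last first.
  by rewrite ler_pM2r ?invr_gt0 ?ltr0n // lerD2r ler_nat.
apply: ge_inf; last by exists U, n, k.
exists (-1)%R => _ [_ [m [j [_ [/has_index_gt0 m_gt0 [_ ->]]]]]].
rewrite ler_pdivlMr ?ltr0n // mulN1r lerBrDr addrC.
by rewrite (@le_trans _ _ 0%R) ?ler0n // subr_le0 ler1n.
Qed.

End RankGradient.

(** * Finite quotients *)

Record finite_quotient (G : group) := FiniteQuotient {
  fq_group : finGroupType;
  fq_map :> G -> fq_group;
  fq_mapM : {morph fq_map : x y / x * y}
}.

Definition fq_ker (G : group) (q : finite_quotient G) : set G :=
  q @^-1` [set 1].
Arguments fq_ker G q x /.

Section FiniteQuotient.
Variables (G : group) (q : finite_quotient G).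
Implicit Types (x y : G) (s : seq G) (S T U : set G).

Lemma fq_map1 : q 1 = 1.
Proof. by apply: (mulgI (q 1)); rewrite -fq_mapM !mulg1. Qed.

Lemma fq_mapV : {morph q : x / x^-1}.
Proof. by move=> x; apply/esym/mulg1_eq; rewrite -fq_mapM mulgV fq_map1. Qed.

Definition fq_image S : {set fq_group q} := [set a in q @` S]%SET.

Lemma fq_imageP S a : reflect (exists2 x, S x & q x = a) (a \in fq_image S).
Proof.
by apply: (iffP idP); rewrite finset.inE; [move/set_mem | move/mem_set].
Qed.

Lemma mem_fq_image S x : S x -> q x \in fq_image S.
Proof. by move=> Sx; apply/fq_imageP; exists x. Qed.

Lemma subgroup_fq_ker : is_subgroup (fq_ker q).
Proof.
split; first exact: fq_map1.
split=> [x y qx qy|x qx] /=.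
  by rewrite fq_mapM qx qy mulg1.
by rewrite fq_mapV qx invg1.
Qed.

Lemma fq_image_subset S T : S `<=` T -> fq_image S \subset fq_image T.
Proof.
move=> ST; apply/fintype.subsetP => _ /fq_imageP[x Sx <-].
by apply: mem_fq_image; exact: ST.
Qed.

Lemma fq_imageU S T : fq_image (S `|` T) = fq_image S :|: fq_image T.
Proof.
apply/setP => a; rewrite finset.in_setU; apply/fq_imageP/orP.
  by move=> [x [Sx|Tx] <-]; [left | right]; exact: mem_fq_image.
by move=> [] /fq_imageP[x STx <-]; exists x => //; [left | right].
Qed.

Lemma card_fq_image_translate S x y :
  (#|fq_image (translate_set x S y)| <= #|fq_image S|)%N.
Proof.
apply: leq_trans (leq_imset_card (fun a => q x * a * q y) _).
apply/subset_leq_card/fintype.subsetP => _ /fq_imageP[_ [z Sz <-] <-].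
by apply/imsetP; exists (q z); [exact: mem_fq_image | rewrite !fq_mapM].
Qed.

Lemma fq_image_group_set U : is_subgroup U -> group_set (fq_image U).
Proof.
move=> Usub; apply/group_setP; split.
  by rewrite -fq_map1; apply: mem_fq_image; exact: subgroup1.
move=> _ _ /fq_imageP[x Ux <-] /fq_imageP[y Uy <-].
by rewrite -fq_mapM; apply: mem_fq_image; exact: subgroupM.
Qed.

Lemma fq_image_leq_index U n (r : nat -> G) : is_subgroup U ->
  (forall i j, (i < j < n)%N -> q ((r i)^-1 * r j) \notin fq_image U) ->
  (n * #|fq_image U| <= #|fq_image setT|)%N.
Proof.
move=> Usub r_inequiv.
pose qU := fingroup.Group (fq_image_group_set Usub).
have setT_sub : is_subgroup [set: G] by [].
pose qG := fingroup.Group (fq_image_group_set setT_sub).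
have qUG : qU \subset qG by exact: fq_image_subset.
rewrite mulnC -(Lagrange qUG) leq_mul2l; apply/orP; right.
pose coset (i : 'I_n) := q (r i) *: qU.
have coset_neq (i j : 'I_n) : (i < j)%N -> coset i <> coset j.
  move=> ij /esym/lcoset_eqP; rewrite mem_lcoset -fq_mapV -fq_mapM; apply/negP.
  by apply: r_inequiv; rewrite ij ltn_ord.
have coset_inj : injective coset.
  move=> i j ij.
  by have [/coset_neq/(_ ij)|/coset_neq/(_ (esym ij))|/val_inj] := ltngtP i j.
rewrite -card_lcosets -[n]card_ord -(card_imset _ coset_inj).
apply/subset_leq_card/fintype.subsetP => _ /imsetP[i _ ->].
by apply/lcosetsP; exists (q (r i)) => //; exact: mem_fq_image.
Qed.

Lemma card_fq_image_le_index U n : is_subgroup U -> U `<=` fq_ker q ->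
  has_index U n -> (#|fq_image setT| <= n)%N.
Proof.
move=> Usub Uker /(has_index_cosets Usub)[c [r [rK cP]]].
rewrite -[n]card_ord -cardsT; apply: leq_trans (leq_imset_card (q \o r) _).
apply/subset_leq_card/fintype.subsetP => _ /fq_imageP[x _ <-].
apply/imsetP; exists (c x); first exact: finset.in_setT.
have /cP/Uker : c (r (c x)) = c x by rewrite rK.
by rewrite /= fq_mapM fq_mapV => /mulg1_eq; rewrite invgK.
Qed.

Section Schreier.
Variable U : set G.
Hypothesis Usub : is_subgroup U.

Lemma fq_imageMr a x : a \in fq_image U -> U x -> a * q x \in fq_image U.
Proof.
move=> /fq_imageP[y Uy <-] Ux; rewrite -fq_mapM.
by apply: mem_fq_image; exact: subgroupM.
Qed.

Lemma fq_image_section : exists t : fq_group q -> G, t 1 = 1 /\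
  forall a, a \in fq_image U -> U (t a) /\ q (t a) = a.
Proof.
have /choice[t tP] a : exists x, a \in fq_image U -> U x /\ q x = a.
  have [/fq_imageP[x Ux <-]|_] := boolP (a \in fq_image U); first by exists x.
  by exists 1.
exists (fun a => if a == 1 then 1 else t a); split=> [|a Ua].
  by rewrite eqxx.
case: eqP => [->|_]; last exact: tP.
by split; [exact: subgroup1 | exact: fq_map1].
Qed.

Variable t : fq_group q -> G.
Hypothesis t1 : t 1 = 1.
Hypothesis tP : forall a, a \in fq_image U -> U (t a) /\ q (t a) = a.

Definition schreier_gen a x := t a * x * (t (a * q x))^-1.

Lemma schreier_gen1 a : schreier_gen a 1 = 1.
Proof. by rewrite /schreier_gen fq_map1 !mulg1 mulgV. Qed.

Lemma schreier_genM a x y :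
  schreier_gen a (x * y) = schreier_gen a x * schreier_gen (a * q x) y.
Proof. by rewrite /schreier_gen fq_mapM !mulgA mulgVK. Qed.

Lemma schreier_genV a x :
  schreier_gen a x^-1 = (schreier_gen (a * q x^-1) x)^-1.
Proof.
by rewrite /schreier_gen !invgM !invgK fq_mapV mulgVK !mulgA.
Qed.

Lemma schreier_gen_in_ker a x : a \in fq_image U -> U x ->
  (U `&` fq_ker q) (schreier_gen a x).
Proof.
move=> Ua Ux; have [Uta qta] := tP Ua.
have [Utax qtax] := tP (fq_imageMr Ua Ux); split.
  apply: (subgroupM Usub); first exact: subgroupM.
  exact: subgroupV.
by rewrite /= !fq_mapM fq_mapV qta qtax mulgV.
Qed.

(* The cocycle identities above make this a subgroup, which is why it suffices
   to look at [x] in a generating set of [U]. *)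
Lemma subgroup_schreier (D : set G) : is_subgroup D -> is_subgroup
  [set x | U x /\ forall a, a \in fq_image U -> D (schreier_gen a x)].
Proof.
move=> Dsub; split.
  split=> [|a _]; first exact: subgroup1.
  by rewrite schreier_gen1; exact: subgroup1.
split=> [x y [Ux Dx] [Uy Dy]|x [Ux Dx]].
  split=> [|a Ua]; first exact: subgroupM.
  rewrite schreier_genM; apply: (subgroupM Dsub); first exact: Dx.
  by apply: Dy; exact: fq_imageMr.
have Ux' := subgroupV Usub Ux; split=> // a Ua.
rewrite schreier_genV; apply: (subgroupV Dsub); apply: Dx.
exact: fq_imageMr.
Qed.

Definition schreier_gens s :=
  [seq schreier_gen a x | a <- enum (fq_image U), x <- s].

Lemma size_schreier_gens s :
  size (schreier_gens s) = (#|fq_image U| * size s)%N.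
Proof. by rewrite size_allpairs cardE. Qed.

Lemma generates_schreier_gens s :
  generates s U -> generates (schreier_gens s) (U `&` fq_ker q).
Proof.
move=> gens x; split.
  apply: generated_min; first exact: (subgroupI Usub subgroup_fq_ker).
  move=> _ /allpairsP[[a y] [/= Ua sy ->]].
  apply: schreier_gen_in_ker; last exact: generates_mem sy.
  by rewrite mem_enum in Ua.
set D := generated _; have Dsub : is_subgroup D := generated_subgroup _.
pose K := [set y | U y /\ forall a, a \in fq_image U -> D (schreier_gen a y)].
have sK y : y \in s -> K y.
  move=> sy; split=> [|a Ua]; first exact: generates_mem sy.
  apply: mem_generated; apply/allpairsP; exists (a, y).
  by rewrite mem_enum.
move=> [/gens/(generated_min (subgroup_schreier Dsub) sK)[_ /(_ 1)] Dx qx].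
have := Dx; rewrite /schreier_gen qx mulg1 t1 invg1 mulg1 mul1g; apply.
by rewrite -fq_map1; apply: mem_fq_image; exact: subgroup1.
Qed.

End Schreier.

Lemma fq_ker_generates s U : is_subgroup U -> generates s U ->
  exists2 s', size s' = (#|fq_image U| * size s)%N &
    generates s' (U `&` fq_ker q).
Proof.
move=> Usub gens; have [t [t1 tP]] := fq_image_section Usub.
exists (schreier_gens U t s); first exact: size_schreier_gens.
exact: generates_schreier_gens.
Qed.

End FiniteQuotient.

Section FineQuotients.
Variable G : group.
Implicit Types (x y : G) (K : set G).

Definition trivial_quotient : finite_quotient G :=
  @FiniteQuotient G {perm bool} (fun=> 1) (fun _ _ => esym (mulg1 1)).

Fact pair_fq_mapM (q q' : finite_quotient G) :
  {morph (fun x => (q x, q' x)) : x y / x * y}.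
Proof. by move=> x y; rewrite !fq_mapM. Qed.

Definition prod_quotient q q' := FiniteQuotient (@pair_fq_mapM q q').

Implicit Types P Q : finite_quotient G -> Prop.

(* [finite_quotient G] lives in a universe too large for the filters of the
   library. *)
Definition eventually P :=
  exists q, forall q' : finite_quotient G, fq_ker q' `<=` fq_ker q -> P q'.

Lemma eventually_ex P : eventually P -> exists q, P q.
Proof. by move=> [q qP]; exists q; exact: qP. Qed.

Lemma eventually_all P : (forall q, P q) -> eventually P.
Proof. by exists trivial_quotient. Qed.

Lemma sub_eventually P Q :
  (forall q, P q -> Q q) -> eventually P -> eventually Q.
Proof. by move=> PQ [q qP]; exists q => q' /qP/PQ. Qed.

Lemma eventuallyI P Q :
  eventually P -> eventually Q -> eventually (fun q => P q /\ Q q).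
Proof.
move=> [q1 q1P] [q2 q2Q]; exists (prod_quotient q1 q2) => q q_ker.
by split; [apply: q1P | apply: q2Q] => x /q_ker[].
Qed.

Lemma eventually_forall (I : finType) (P : I -> finite_quotient G -> Prop) :
  (forall i, eventually (P i)) -> eventually (fun q => forall i, P i q).
Proof.
move=> evP; suff: eventually (fun q => forall i, i \in enum I -> P i q).
  by apply: sub_eventually => q qP i; apply: qP; rewrite mem_enum.
elim: (enum I) => [|j s IH]; first exact: eventually_all.
apply: sub_eventually (eventuallyI (evP j) IH) => q [Pj Ps] i.
by rewrite inE => /predU1P[->|/Ps].
Qed.

(* [G] acts on the cosets of [K]; the inverse turns the left action into a right
   one, as composition of permutations requires. *)
Lemma finite_index_fq_ker_sub K : is_subgroup K -> finite_index K ->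
  exists q : finite_quotient G, fq_ker q `<=` K.
Proof.
move=> Ksub [n /(has_index_cosets Ksub)[c [r [rK cP]]]].
pose act x i := c (x^-1 * r i).
have act_c x y : act x (c y) = c (x^-1 * y).
  by apply/cP; rewrite invgM invgK -mulgA mulVKg; apply/cP; rewrite rK.
have actK x : cancel (act x) (act x^-1).
  by move=> i; rewrite {2}/act act_c invgK mulVKg rK.
pose phi x := perm (can_inj (actK x)).
have phiM : {morph phi : x y / x * y}.
  move=> x y; apply/perm.permP => i.
  by rewrite permM !permE [act x i]/act act_c /act invgM mulgA.
exists (FiniteQuotient phiM) => x /perm.permP/(_ (c 1)).
rewrite permE perm1 act_c mulg1 => /cP.
by rewrite invgK mulg1.
Qed.

End FineQuotients.

(** * Coverings by thin subgroups *)

Section ThinSubgroups.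
Variable G : group.
Implicit Types (g x y : G) (S T U A B : set G).

Definition thin U := is_subgroup U /\ fin_gen U /\ ~ finite_index U.

Lemma thin_conj U g : thin U -> thin (conj_set U g).
Proof.
move=> [Usub [[s gens] Uinf]]; split; first exact: subgroup_conj.
split; first by exists [seq x ^ g^-1 | x <- s]; exact: generates_conj.
by apply: contra_not Uinf => -[n Un]; exists n; exact: has_index_conj Un.
Qed.

Definition negligible S := forall n, eventually (fun q : finite_quotient G =>
  (n * #|fq_image q S| <= #|fq_image q setT|)%N).

Lemma sub_negligible S T : S `<=` T -> negligible T -> negligible S.
Proof.
move=> ST Tneg n; apply: sub_eventually (Tneg n) => q; apply: leq_trans.
by rewrite leq_mul2l subset_leq_card ?orbT //; exact: fq_image_subset.
Qed.

Lemma negligible0 : negligible set0.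
Proof.
move=> n; apply: eventually_all => q.
have -> : fq_image q set0 = finset.set0.
  by apply/setP => a; rewrite finset.in_set0; apply/negP => /fq_imageP[].
by rewrite cards0 muln0.
Qed.

Lemma negligibleU S T : negligible S -> negligible T -> negligible (S `|` T).
Proof.
move=> Sneg Tneg n.
apply: sub_eventually (eventuallyI (Sneg n.*2) (Tneg n.*2)) => q [Sq Tq].
have : (n * #|fq_image q (S `|` T)| <=
  n * (#|fq_image q S| + #|fq_image q T|))%N.
  by rewrite leq_mul2l fq_imageU leq_card_setU orbT.
lia.
Qed.

Lemma negligible_translate x y S :
  negligible S -> negligible (translate_set x S y).
Proof.
move=> Sneg n; apply: sub_eventually (Sneg n) => q; apply: leq_trans.
by rewrite leq_mul2l card_fq_image_translate orbT.
Qed.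

Lemma not_negligible_setT : ~ negligible setT.
Proof.
move=> /(_ 2) /eventually_ex[q]; rewrite leqNgt; apply/negP/negPn.
rewrite ltn_Pmull //; apply/card_gt0P.
by exists (q 1); exact: mem_fq_image.
Qed.

(* By Schreier's lemma [U ∩ ker q] has at most [d(U) |q(U)|] generators. *)
Lemma negligible_fq_ker_few_generators U (e : Rdefinitions.R) :
  is_subgroup U -> fin_gen U -> negligible U -> (0 < e)%R ->
  eventually (fun q => exists2 s, generates s (U `&` fq_ker q) &
    ((size s)%:R <= e * #|fq_image q setT|%:R)%R).
Proof.
move=> Usub [s gens] Uneg e_gt0.
pose n := Num.bound ((size s)%:R / e)%R.
have size_lt : ((size s)%:R < e * n%:R)%R.
  by rewrite mulrC -ltr_pdivrMr // archi_boundP // divr_ge0 ?ler0n // ltW.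
apply: sub_eventually (Uneg n) => q qU.
have [s' size_s' gens'] := fq_ker_generates q Usub gens; exists s' => //.
rewrite size_s' natrM (@le_trans _ _ (#|fq_image q U|%:R * (e * n%:R))%R) //.
  by rewrite ler_wpM2l ?ler0n // ltW.
by rewrite mulrC -mulrA -natrM ler_wpM2l ?ler_nat // ltW.
Qed.

Inductive thinly_covered : set G -> Prop :=
| thin_thinly_covered U : thin U -> thinly_covered U
| thinly_covered0 : thinly_covered set0
| thinly_coveredU S T :
    thinly_covered S -> thinly_covered T -> thinly_covered (S `|` T)
| sub_thinly_covered S T :
    S `<=` T -> thinly_covered T -> thinly_covered S
| thinly_covered_translate x y S :
    thinly_covered S -> thinly_covered (translate_set x S y).

Lemma thinly_covered_bigcup (I : finType) (S : I -> set G) :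
  (forall i, thinly_covered (S i)) -> thinly_covered (\bigcup_i S i).
Proof.
move=> Scov; rewrite (_ : [set: I] = [set` enum I]).
  rewrite bigcup_seq; elim/big_rec: _ => [|i T _ Tcov].
    exact: thinly_covered0.
  exact: thinly_coveredU.
by apply/seteqP; split=> i //= _; rewrite mem_enum.
Qed.

Section Separability.
Hypothesis LERF_G : LERF G.

Lemma LERF_finite_index U x : is_subgroup U -> fin_gen U -> ~ U x ->
  exists K, [/\ is_subgroup K, finite_index K, U `<=` K & ~ K x].
Proof.
move=> Usub Ufg Ux; have [C [C_fin UC]] := LERF_G Usub Ufg.
have [K CK Kx] : exists2 K, C K & ~ K x.
  apply: contra_notP Ux => CK; apply/UC => K CKK.
  by apply: contrapT => Kx; apply: CK; exists K.
have [Ksub Kfin] := C_fin K CK; exists K; split=> // y /UC; exact.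
Qed.

Lemma eventually_notin_fq_image U x : is_subgroup U -> fin_gen U -> ~ U x ->
  eventually (fun q => q x \notin fq_image q U).
Proof.
move=> Usub Ufg /(LERF_finite_index Usub Ufg)[K [Ksub Kfin UK Kx]].
have [q q_ker] := finite_index_fq_ker_sub Ksub Kfin.
exists q => // q' q'_ker; apply/negP => /fq_imageP[y Uy /= qyx].
apply: Kx; rewrite -[x](mulVKg y); apply: (subgroupM Ksub); first exact: UK.
by apply/q_ker/q'_ker; rewrite /= fq_mapM fq_mapV qyx mulVg.
Qed.

Lemma negligible_thin U : thin U -> negligible U.
Proof.
move=> [Usub [Ufg Uinf]] n.
have [r r_inequiv] := infinite_index_inequiv n Usub Uinf.
have : eventually (fun q => forall ij : 'I_n * 'I_n,
    (ij.1 < ij.2)%N -> q ((r ij.1)^-1 * r ij.2) \notin fq_image q U).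
  apply: eventually_forall => -[i j] /=; have [ij|_] := ltnP i j; last first.
    exact: eventually_all.
  have Uij : ~ U ((r i)^-1 * r j) by apply: r_inequiv; rewrite ij ltn_ord.
  by apply: sub_eventually (eventually_notin_fq_image Usub Ufg Uij) => q.
apply: sub_eventually => q q_inequiv.
apply: (fq_image_leq_index (r := r)) => // i j /andP[ij jn].
have i_lt := ltn_trans ij jn; exact: (q_inequiv (Ordinal i_lt, Ordinal jn) ij).
Qed.

Lemma negligible_thinly_covered S : thinly_covered S -> negligible S.
Proof.
elim=> {S} [U||S T _ + _|S T ST _|x y S _].
- exact: negligible_thin.
- exact: negligible0.
- exact: negligibleU.
- exact: sub_negligible.
- exact: negligible_translate.
Qed.

Section PositiveRankGradient.
Hypothesis rank_gradient_gt0 : (0 < rank_gradient G)%R.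

Lemma infinite_index_few_generators (q : finite_quotient G) s U :
  is_subgroup U -> generates s U -> U `<=` fq_ker q ->
  ((size s)%:R <= rank_gradient G * #|fq_image q setT|%:R)%R ->
  ~ finite_index U.
Proof.
move=> Usub gens Uker few [n Un].
have := rank_gradient_le Usub gens Un; rewrite leNgt => /negP; apply.
rewrite ltrBlDr; apply: le_lt_trans few _; rewrite ltr_pwDr ?ltr01 //.
rewrite ler_wpM2l ?ler_nat ?(ltW rank_gradient_gt0) //.
exact: card_fq_image_le_index Un.
Qed.

Lemma thin_set1 : thin [set 1].
Proof.
have gens : generates [::] [set 1 : G].
  move=> x; split; first exact: (generated_min (subgroup_set1 G)).
  by move=> ->; apply: subgroup1; exact: generated_subgroup.
split; first exact: subgroup_set1.
split; first by exists [::].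
apply: (infinite_index_few_generators (subgroup_set1 G) gens
  (q := trivial_quotient G)) => //.
by rewrite mulr_ge0 ?ler0n // ltW.
Qed.

Lemma thin_fq_ker_join A B : thin A -> thin B ->
  exists (q : finite_quotient G) (C : set G),
    [/\ thin C, A `&` fq_ker q `<=` C & B `&` fq_ker q `<=` C].
Proof.
move=> thA thB.
have few U : thin U -> eventually (fun q => exists2 s,
    generates s (U `&` fq_ker q) &
    ((size s)%:R <= rank_gradient G / 2 * #|fq_image q setT|%:R)%R).
  move=> thU; have [Usub [Ufg _]] := thU.
  apply: negligible_fq_ker_few_generators => //; first exact: negligible_thin.
  by rewrite divr_gt0.
have [q [[sA gensA sizeA] [sB gensB sizeB]]] :=
  eventually_ex (eventuallyI (few A thA) (few B thB)).
pose s := sA ++ sB; exists q, (generated s); split.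
- split; first exact: generated_subgroup.
  split; first by exists s.
  apply: (infinite_index_few_generators (q := q) (s := s)) => //.
  + exact: generated_subgroup.
  + apply: generated_min; first exact: subgroup_fq_ker.
    by move=> x; rewrite mem_cat => /orP[/(generates_mem gensA)|
      /(generates_mem gensB)] [].
  + rewrite size_cat natrD [rank_gradient G]splitr mulrDl.
    exact: lerD.
- move=> x /gensA; apply: generated_min; first exact: generated_subgroup.
  by move=> y sy; apply: mem_generated; rewrite mem_cat sy.
- move=> x /gensB; apply: generated_min; first exact: generated_subgroup.
  by move=> y sy; apply: mem_generated; rewrite mem_cat sy orbT.
Qed.

Lemma thinly_covered_mul_thin A B : thin A -> thin B ->
  thinly_covered (mul_set A B).
Proof.
move=> thA thB; have [q [C [thC AC BC]]] := thin_fq_ker_join thA thB.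
pose fiber S a := S `&` q @^-1` [set a].
apply: (@sub_thinly_covered _ (\bigcup_(p : fq_group q * fq_group q)
  mul_set (fiber A p.1) (fiber B p.2))).
  move=> _ [a Aa [b Bb <-]]; exists (q a, q b) => //.
  by exists a => //; exists b.
apply: thinly_covered_bigcup => p; set AB := mul_set _ _.
have [->|/set0P[_ [x [Ax qx] [y [By qy] _]]]] := eqVneq AB set0.
  exact: thinly_covered0.
apply: sub_thinly_covered
  (thinly_covered_translate x y (thin_thinly_covered thC)).
move=> _ [a [Aa qa] [b [Bb qb] <-]].
exists (x^-1 * a * (b / y)); last by rewrite -!mulgA mulVKg mulVg mulg1.
have [[Asub _] [Bsub _]] := (thA, thB); have [Csub _] := thC.
apply: (subgroupM Csub).
  apply: AC; split; first by apply: subgroupM => //; exact: subgroupV.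
  by rewrite /= fq_mapM fq_mapV qx qa mulVg.
apply: BC; split; first by apply: subgroupM => //; exact: subgroupV.
by rewrite /= fq_mapM fq_mapV qy qb mulgV.
Qed.

Lemma thinly_covered_mul S B : thinly_covered S -> thin B ->
  thinly_covered (mul_set S B).
Proof.
move=> Scov; elim: Scov B => {S}.
- by move=> A thA B; exact: thinly_covered_mul_thin.
- move=> B _; apply: sub_thinly_covered thinly_covered0.
  by move=> _ [x []].
- move=> S T _ IHS _ IHT B thB.
  apply: sub_thinly_covered (thinly_coveredU (IHS B thB) (IHT B thB)).
  by move=> _ [x [Sx|Tx] [b Bb <-]]; [left | right]; exists x => //; exists b.
- move=> S T ST _ IHT B thB; apply: sub_thinly_covered (IHT B thB).
  by move=> _ [x /ST Tx [b Bb <-]]; exists x => //; exists b.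
- move=> x y S _ IH B thB.
  have := thinly_covered_translate x y (IH _ (thin_conj y thB)).
  apply: sub_thinly_covered => _ [_ [z Sz <-] [b Bb <-]].
  exists (z * b ^ y^-1).
    by exists z => //; exists (b ^ y^-1) => //=; rewrite conjgKV.
  by rewrite conjgE invgK -!mulgA mulVg mulg1.
Qed.

End PositiveRankGradient.
End Separability.
End ThinSubgroups.

Theorem theorem1p2 (G : group) (n : nat) (H : nat -> G -> Prop) :
  fin_gen_group G -> LERF G -> (0 < rank_gradient G)%R ->
  (forall i, (i < n)%N -> is_subgroup (H i) /\ fin_gen (H i) /\ ~ finite_index (H i)) ->
  exists g : G, ~ prod_set H n g.
Proof.
move=> _ LERF_G rg_gt0 thH.
have prod_cov : thinly_covered (prod_set H n).
  elim: n thH => [|n IH] thH.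
    exact/thin_thinly_covered/thin_set1.
  have prod_n_cov : thinly_covered (prod_set H n).
    by apply: IH => i i_lt; apply: thH; exact: ltnW.
  have thHn : thin (H n) by exact: thH.
  apply: sub_thinly_covered (thinly_covered_mul LERF_G rg_gt0 prod_n_cov thHn).
  by move=> _ [x [h [px [Hh ->]]]]; exists x => //; exists h.
apply/existsNP => prod_full; apply: (@not_negligible_setT G).
by apply: sub_negligible (negligible_thinly_covered LERF_G prod_cov) => g _.
Qed.
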